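(* Let $k\geq 1$ and $m\geq 0$ be integers. If $X$ is a metric space with $\dim X\geq k+m$, then there exists a closed $\partial\Delta^k$-tuple $\mathcal F$ of $X$ such that every $\partial\Delta^k$-neighbourhood $\mathcal U$ of $\mathcal F$ satisfies the following alternative: $\dim\big(\partial\Delta^k\text{-}\mathrm{obs}\,\mathcal U\big)=m$, or the corresponding $\partial\Delta^k$-partition $P=X\setminus\bigcup\mathcal U$ has $\dim P>m$. In particular, if $n\geq 1$ is an integer and $X$ is a metric space with $\dim X=k(n+1)-1$, then $\partial\Delta^k\text{-}\mathrm{Ind}\,X=n$ and $\partial\Delta^k\text{-}\mathrm{str}\,X=1$.
   Context: $\dim$ is covering dimension. $\Delta^k$ is the $k$-dimensional simplex with vertices $e_0,\dots,e_k$; $K=\partial\Delta^k$ is the simplicial complex of all its faces of dimension at most $k-1$. $K$-tuples. For $K=\partial\Delta^k$, a $K$-tuple of a space $X$ is a $(k+1)$-tuple $\mathcal A=(A_0,\dots,A_k)$ of subsets of $X$ with $\bigcap_{i=0}^kA_i=\emptyset$. It is open (closed) if all $A_i$ are. $\bigcup\mathcal A=\bigcup_iA_i$. If $\mathcal A$ is an open $K$-tuple and $B_i\subset A_i$ for all $i$, then $\mathcal A$ is a $K$-neighbourhood of $\mathcal B=(B_0,\dots,B_k)$ and $P=X\setminus\bigcup\mathcal A$ is a $K$-partition for $\mathcal B$ (corresponding to $\mathcal A$). $K\text{-}\mathrm{Ind}$ (normal $X$; values: ordinals, $-1$, $\infty$): $K\text{-}\mathrm{Ind}\,X=-1$ iff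 $X=\emptyset$; for an ordinal $\alpha$, $K\text{-}\mathrm{Ind}\,X\le\alpha$ iff every closed $K$-tuple of $X$ has a $K$-partition $P$ with $K\text{-}\mathrm{Ind}\,P<\alpha$; for $X\neq\emptyset$ the value is the least such ordinal $\alpha$, or $\infty$ if none. Obstruction points and strength degree. For an open $K$-tuple $\mathcal U$ of $X$, $K\text{-}\mathrm{obs}\,\mathcal U$ is the set of points $x\in X$ such that $\mathcal U$ has no $K$-neighbourhood $\mathcal V$ with $x\in\bigcup\mathcal V$. $K\text{-}\mathrm{str}\,X\in\{0,1\}$: if $\alpha=K\text{-}\mathrm{Ind}\,X\in\{-1,0,\infty\}$, then $K\text{-}\mathrm{str}\,X=0$. If $0<\alpha<\infty$, then $K\text{-}\mathrm{str}\,X=0$ when every closed $K$-tuple of $X$ has a $K$-neighbourhood $\mathcal U$ with $K\text{-}\mathrm{obs}\,\mathcal U=\emptyset$ and $K\text{-}\mathrm{Ind}(X\setminus\bigcup\mathcal U)<\alpha$, and $K\text{-}\mathrm{str}\,X=1$ otherwise. *)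

(* Defs.v *)
From mathcomp Require Import all_boot all_order all_algebra.
From mathcomp Require Import all_classical all_reals all_analysis.

Set Implicit Arguments.
Unset Strict Implicit.
Unset Printing Implicit Defensive.

Import Order.TTheory GRing.Theory Num.Theory.
Local Open Scope classical_set_scope.
Local Open Scope ring_scope.

(* Subspaces: a set A : set X coerces to the type set_type A, which carries the
   subspace topology (the initial topology of the inclusion). It may be empty,
   since topologicalType does not require a point. *)

(** Covering dimension *)

Definition finite_open_cover (X : topologicalType) (n : nat)
    (U : 'I_n -> set X) : Prop :=
  (forall i, open (U i)) /\ \bigcup_i U i = [set: X].

(* Families are indexed, so repeated members are counted with multiplicity;
   this is harmless because repetitions can be dropped from the refinement. *)
Definition covdim_le (X : topologicalType) (d : nat) : Prop :=
  forall (n : nat) (U : 'I_n -> set X), finite_open_cover U ->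
  exists (p : nat) (V : 'I_p -> set X),
    [/\ finite_open_cover V,
        forall j, exists i, V j `<=` U i &
        forall x : X, (#|[pred j : 'I_p | x \in V j]| <= d.+1)%N].

Definition covdim (X : topologicalType) : \bar int :=
  if `[< [set: X] = set0 >] then (-1)%:E
  else if pselect (exists d, `[< covdim_le X d >]) is left ex
       then (ex_minn ex)%:Z%:E
       else +oo%E.

(** Ordinals *)

(* Osup f denotes the least ordinal strictly above all the f i. Each ordinal
   has many representations: a and b denote the same ordinal iff
   ole a b /\ ole b a. *)
Inductive Ord : Type := Osup (T : Type) (f : T -> Ord).

Fixpoint ole (a b : Ord) : Prop :=
  match a, b with
  | Osup T f, Osup T2 g => forall i, exists j, ole (f i) (g j)
  end.

Definition olt (a b : Ord) : Prop :=
  match b with Osup T2 g => exists j, ole a (g j) end.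

Fixpoint ord_of_nat (n : nat) : Ord :=
  match n with
  | 0%N => Osup (fun e : Empty_set => match e with end)
  | n'.+1 => Osup (fun _ : unit => ord_of_nat n')
  end.

Lemma ole_refl a : ole a a.
Proof. by elim: a => T f IH i; exists i; exact: IH. Qed.

Lemma ole_trans a b c : ole a b -> ole b c -> ole a c.
Proof.
elim: a b c => T f IH [T2 g] [L h] /= fg gh i.
have [j fgj] := fg i; have [l ghl] := gh j.
by exists l; exact: IH fgj ghl.
Qed.

Lemma ole_or_olt a b : ole a b \/ olt b a.
Proof.
elim: a b => T f IH [T2 g]; have [|] := pselect (ole (Osup f) (Osup g)).
  by left.
move=> /existsNP[i /forallNP nfg]; right; exists i.
have {}nfg j : olt (g j) (f i) by case: (IH i (g j)) => // /nfg.
by case: (f i) nfg => T3 h /=.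
Qed.

Lemma olt_wf : well_founded olt.
Proof.
suff acc a b : ole b a -> Acc olt b by move=> a; exact: acc (ole_refl a).
elim: a b => T f IH [T2 g] ba; constructor => c [j cg].
by have [i gf] := ba j; apply: (IH i); exact: ole_trans cg gf.
Qed.

(** Tuples for K = boundary of the k-simplex; the vertices are 'I_k.+1 *)

Definition is_Ktuple (k : nat) (X : Type) (A : 'I_k.+1 -> set X) : Prop :=
  \bigcap_i A i = set0.

Definition open_Ktuple (k : nat) (X : topologicalType)
    (A : 'I_k.+1 -> set X) : Prop :=
  is_Ktuple A /\ forall i, open (A i).

Definition closed_Ktuple (k : nat) (X : topologicalType)
    (A : 'I_k.+1 -> set X) : Prop :=
  is_Ktuple A /\ forall i, closed (A i).

Definition K_nbhd (k : nat) (X : topologicalType)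
    (B A : 'I_k.+1 -> set X) : Prop :=
  open_Ktuple A /\ forall i, B i `<=` A i.

Definition K_compl (k : nat) (X : Type) (A : 'I_k.+1 -> set X) : set X :=
  ~` \bigcup_i A i.

Definition K_partition (k : nat) (X : topologicalType)
    (B : 'I_k.+1 -> set X) (P : set X) : Prop :=
  exists A, K_nbhd B A /\ P = K_compl A.

Definition K_obs (k : nat) (X : topologicalType)
    (U : 'I_k.+1 -> set X) : set X :=
  [set x | ~ exists V, K_nbhd U V /\ (\bigcup_i V i) x].

(** K-Ind *)

(* In the last clause, "K-Ind P < Osup f" is unfolded to
   "K-Ind P = -1, or K-Ind P <= f i for some i"; KInd_leP gives the
   presentation-independent form. *)
Fixpoint KInd_le (k : nat) (a : Ord) (X : topologicalType) : Prop :=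
  match a with
  | Osup T f =>
      forall F : 'I_k.+1 -> set X, closed_Ktuple F ->
      exists P : set X, K_partition F P /\
        (P = set0 \/ exists i, KInd_le k (f i) P)
  end.

Definition KInd_lt (k : nat) (a : Ord) (X : topologicalType) : Prop :=
  [set: X] = set0 \/ exists b, olt b a /\ KInd_le k b X.

Lemma set_type_eq0 (T : Type) (P : set T) : [set: P] = set0 <-> P = set0.
Proof.
split=> [P0|P0].
- rewrite -subset0 => x Px.
  by have : [set: P] (exist _ x (mem_set Px)) by []; rewrite P0.
- rewrite -subset0 => -[x Px] _ /=.
  by move/set_mem: Px; rewrite P0.
Qed.

Lemma KInd_le_mono k a b X : ole a b -> KInd_le k a X -> KInd_le k b X.
Proof.
elim: a b X => T f IH [T2 g] X /= ab aX F /aX [P [FP PI]].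
exists P; split=> //; case: PI => [->|[i Pi]]; [by left|right].
by have [j fg] := ab i; exists j; exact: IH fg Pi.
Qed.

Lemma KInd_leP k a X :
  KInd_le k a X <->
  forall F : 'I_k.+1 -> set X, closed_Ktuple F ->
  exists P : set X, K_partition F P /\ KInd_lt k a P.
Proof.
case: a => T f; split=> aX F /aX [P [FP PI]]; exists P; split=> //.
- case: PI => [/set_type_eq0|[i Pi]]; [by left|right].
  by exists (f i); split=> //=; exists i; exact: ole_refl.
- case: PI => [/set_type_eq0|[b [[i bi] Pb]]]; [by left|right].
  by exists i; exact: KInd_le_mono bi Pb.
Qed.

Inductive Ind_value : Type := Ind_minus1 | Ind_ord of Ord | Ind_infty.

(* KInd_is k X v means K-Ind X = v; values Ind_ord are determined up to the
   equivalence ole a b /\ ole b a. *)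
Definition KInd_is (k : nat) (X : topologicalType) (v : Ind_value) : Prop :=
  match v with
  | Ind_minus1 => [set: X] = set0
  | Ind_ord a =>
      [/\ [set: X] <> set0, KInd_le k a X &
          forall b, KInd_le k b X -> ole a b]
  | Ind_infty => [set: X] <> set0 /\ forall a, ~ KInd_le k a X
  end.

Lemma KInd_is_total k X : exists v, KInd_is k X v.
Proof.
have [X0|X0] := pselect ([set: X] = set0); first by exists Ind_minus1.
have [[a aX]|nX] := pselect (exists a, KInd_le k a X); last first.
  by exists Ind_infty; split=> // a aX; apply: nX; exists a.
elim/(well_founded_ind olt_wf): a aX => a IH aX.
have [[b [bX ba]]|na] := pselect (exists b, KInd_le k b X /\ olt b a).
  exact: IH ba bX.
exists (Ind_ord a); split=> // b bX.
by case: (ole_or_olt a b) => // ba; case: na; exists b.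
Qed.

(** K-str *)

Definition Kstr_zero (k : nat) (X : topologicalType) : Prop :=
  [\/ KInd_is k X Ind_minus1,
      KInd_is k X (Ind_ord (ord_of_nat 0%N)),
      KInd_is k X Ind_infty |
      exists a, [/\ KInd_is k X (Ind_ord a), olt (ord_of_nat 0%N) a &
        forall F : 'I_k.+1 -> set X, closed_Ktuple F ->
        exists U, [/\ K_nbhd F U, K_obs U = set0 & KInd_lt k a (K_compl U)]]].

Definition Kstr (k : nat) (X : topologicalType) : nat :=
  if `[< Kstr_zero k X >] then 0%N else 1%N.

(* Main.v *)
Require Import Defs.
From mathcomp Require Import all_boot all_order all_algebra.
From mathcomp Require Import all_classical all_reals all_analysis.
From mathcomp Require Import lra zify.
From mathcomp Require wochoice.

Set Implicit Arguments.
Unset Strict Implicit.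
Unset Printing Implicit Defensive.

Import Order.TTheory GRing.Theory Num.Theory.
Import numFieldNormedType.Exports.
Local Open Scope classical_set_scope.
Local Open Scope ring_scope.

(** Why the proposition is true.  Write [dim A < e] for subsets [A] of a fixed
space, so that all covers consist of open sets of the ambient space.

The main tool is the decomposition of a closed set [A] with [dim A < e] into
[e] zero-dimensional pieces ([zero_dim_decomposition]).  It is obtained from
covers by finitely many sets, although the space need not be separable, as
follows.  The construction of Stone gives countably many disjoint families of
open sets, together with closed sets inside their unions, that form a base
([sigma_disjoint_base]).  Hence a set is zero-dimensional as soon as it misses
a partition for each of countably many pairs of disjoint closed sets
([zero_dim_of_partitions]).  Take [e] copies of this sequence of pairs.  By the
theorem of Eilenberg and Otto on partitions ([partition_tuple]), applied once
for each choice of one pair in each copy, all these partitions can be chosen so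
that [e] of them taken from the [e] different copies never meet in [A]
([generic_partitions]).  A point of [A] then misses all the partitions of some
copy, and the [j]-th piece consists of the points that miss those of the
[j]-th copy.

This yields both directions of the link between closed [k]-tuples and [dim].

- If [dim X < k + m], then a neighbourhood of the tuple can be found whose union
  contains the first [k] pieces, so the partition lies in the other [m] pieces
  and has [dim < m] ([K_nbhd_of_dim_lt]).

- If each closed [k]-tuple has a partition with [dim < m], then
  [dim X < k + m] ([dim_lt_of_K_nbhd]): a closed tuple of [k + m + 1] sets is
  treated by intersecting the last [m + 1] of them, and then by expanding these
  [m + 1] sets over the resulting partition.

Suppose that an open tuple has a partition of dimension at most [m] and an
obstruction set of dimension less than [m].  A point outside the obstruction
set can be added to the tuple, and one zero-dimensional piece of the partition
can be added all at once outside the obstruction set, so that the remaining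
partition has dimension less than [m] ([K_nbhd_enlarge]).  Therefore, if
[dim X >= k + m], the closed tuple given by the second item (all of whose
partitions have dimension at least [m]) satisfies the alternative.

By induction on [n], the two items say that [K-Ind X <= n] exactly when
[dim X < k * (n + 1)] ([KInd_le_ord_of_nat]).  If [dim X = k * (n + 1) - 1],
the alternative for [m = k * n - 1] excludes a neighbourhood without
obstruction points whose partition has [K-Ind] less than [n]. *)

(** * Covering dimension of subsets *)

(** The covers are made of open sets of the ambient space, which avoids
subspace topologies; [e] bounds the number of members through a point, so
[e = 0] means that [A] is empty, that is, of dimension -1. *)
Definition dim_lt (X : topologicalType) (A : set X) (e : nat) : Prop :=
  forall (n : nat) (G : 'I_n -> set X), (forall i, open (G i)) ->
  A `<=` \bigcup_i G i ->
  exists (p : nat) (V : 'I_p -> set X),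
    [/\ forall j, open (V j), A `<=` \bigcup_j V j,
        forall j, exists i, V j `<=` G i &
        forall x, A x -> (#|[pred j : 'I_p | x \in V j]| <= e)%N].

Section covers.
Context {X : topologicalType}.
Implicit Types (A B P : set X) (e m : nat).

Lemma ord_family (J : finType) (V : J -> set X) :
  exists (p : nat) (V' : 'I_p -> set X),
    [/\ forall j', exists j, V' j' = V j, forall j, exists j', V' j' = V j &
        forall x, #|[pred j' | x \in V' j']| = #|[pred j | x \in V j]|].
Proof.
exists #|J|, (V \o enum_val); split=> [j'|j|x].
- by exists (enum_val j').
- by exists (enum_rank j); rewrite /= enum_rankK.
- rewrite -(fintype.card_image (@enum_val_inj J predT)); apply: eq_card => j.
  rewrite inE; apply/fintype.imageP/idP => [[j' + ->]|xj]; first by rewrite inE.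
  exists (enum_rank j); last by rewrite enum_rankK.
  by move: xj; rewrite !inE /= enum_rankK.
Qed.

Lemma dim_lt_fin A e (I : finType) (G : I -> set X) : dim_lt A e ->
  (forall i, open (G i)) -> A `<=` \bigcup_i G i ->
  exists (p : nat) (V : 'I_p -> set X),
    [/\ forall j, open (V j), A `<=` \bigcup_j V j,
        forall j, exists i, V j `<=` G i &
        forall x, A x -> (#|[pred j : 'I_p | x \in V j]| <= e)%N].
Proof.
have [n [G' [G'G GG' _]]] := ord_family G.
move=> dA oG AG; have [||p [V [oV AV VG' card_V]]] := dA n G'.
- by move=> i; have [j ->] := G'G i.
- by move=> x /AG[i _ Gi]; have [j Gj] := GG' i; exists j; rewrite ?Gj.
exists p, V; split=> // j; have [i VG] := VG' j.
by have [i' Gi] := G'G i; exists i'; rewrite -Gi.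
Qed.

Lemma dim_lt0 A : dim_lt A 0 -> A = set0.
Proof.
move=> dA; have [||p [V [_ AV _ card_V]]] := dA 1%N (fun=> setT).
- by move=> _; exact: openT.
- by move=> x _; exists ord0.
rewrite -subset0 => x Ax; have [j _ Vj] := AV x Ax.
have := card_V x Ax; rewrite leqn0 => /eqP/card0_eq/(_ j).
by rewrite !inE mem_set.
Qed.

Lemma dim_lt_mono A e e' : (e <= e')%N -> dim_lt A e -> dim_lt A e'.
Proof.
move=> ee' dA n G oG AG; have [p [V [oV AV VG card_V]]] := dA n G oG AG.
by exists p, V; split=> // x Ax; exact: leq_trans (card_V x Ax) ee'.
Qed.

(** For closed [A], this is [dim A < m] expressed through closed tuples of
[m + 1] sets: it says that the open cover by their complements has a shrinking
whose members have no common point in [A]. *)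
Definition expandable A m : Prop :=
  forall F : 'I_m.+1 -> set X, (forall i, closed (F i)) ->
  A `&` \bigcap_i F i = set0 ->
  exists E : 'I_m.+1 -> set X,
    [/\ forall i, closed (E i), forall i, F i `<=` E i,
        A `<=` \bigcup_i E i & A `&` \bigcap_i E i = set0].

(** In a refinement of order at most [m] of the cover by the complements of the
[F i], merge the members that are sent to the same [i]. The [m + 1] open sets
[W i] so obtained have no common point in [A], and [E i] adds to [F i] the
points of [A] outside [W i]. *)
Lemma dim_lt_expand A m (F : 'I_m.+1 -> set X) :
  closed A -> dim_lt A m -> (forall i, closed (F i)) ->
  A `&` \bigcap_i F i = set0 ->
  exists E : 'I_m.+1 -> set X,
    [/\ forall i, closed (E i), forall i, F i `<=` E i,
        A `<=` \bigcup_i E i, A `&` \bigcap_i E i = set0 &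
        \bigcap_i E i `<=` \bigcap_i F i].
Proof.
move=> cA dA cF AF0.
have [||p [V [oV AV VF card_V]]] := dA _ (fun i => ~` F i).
- by move=> i; exact: closed_openC.
- move=> x Ax; apply: contrapT => nx.
  suff : (A `&` \bigcap_i F i) x by rewrite AF0.
  by split=> // i _; apply: contrapT => nFi; apply: nx; exists i.
have [f Vf] := choice VF.
pose W i := \bigcup_(j in [set j | f j = i]) V j.
have WF i : W i `<=` ~` F i by move=> x [j <- /Vf].
have W0 x : A x -> exists i, ~ W i x.
  move=> Ax; apply: contrapT => /forallNP nW.
  have WT i : exists j, f j = i /\ V j x.
    by have [j fj Vj] := contrapT (nW i); exists j.
  have [g fg] := choice WT.
  have g_inj : injective g.
    by move=> i j gij; rewrite -(fg i).1 -(fg j).1 gij.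
  have : (#|[seq g i | i in 'I_m.+1]| <= #|[pred j | x \in V j]|)%N.
    apply/subset_leq_card/fintype.subsetP => _ /fintype.imageP[i _ ->].
    by rewrite inE; exact: (fg i).2.
  rewrite fintype.card_image // card_ord => /leq_trans/(_ (card_V x Ax)).
  by rewrite ltnn.
have AE0 : A `&` \bigcap_i (F i `|` A `&` ~` W i) = set0.
  rewrite -subset0 => x [Ax FWx]; have [j _ Vj] := AV x Ax.
  have Wj : W (f j) x by exists j.
  by case: (FWx (f j) I) => [/(WF _ _ Wj)|[_ /(_ Wj)]].
exists (fun i => F i `|` A `&` ~` W i); split=> //.
- move=> i; apply: closedU => //; apply: closedI => //.
  by apply: open_closedC; apply: bigcup_open.
- by move=> x Ax; have [i nWi] := W0 x Ax; exists i => //; right.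
- move=> x Ex; have [Ax|nAx] := pselect (A x).
    by suff : set0 x by []; rewrite -AE0.
  by move=> i _; case: (Ex i I) => [//|[/nAx]].
Qed.

(** Split a cover indexed by ['I_n] into [m + 1] classes by a map [c], and
shrink the unions of the classes until they have no common point in [A]. After
this has been done for each [c], a point of [A] lies in at most [m] members,
since [m + 1] members through it could be put in different classes by some
[c]. *)
Lemma expandable_dim_lt A m : expandable A m -> dim_lt A m.
Proof.
move=> xA n G oG AG.
pose good (G' : 'I_n -> set X) (c : {ffun 'I_n -> 'I_m.+1}) :=
  forall x, A x -> exists a, forall i, c i = a -> ~ G' i x.
have [G' [oG' AG' G'G gG']] : exists G' : 'I_n -> set X,
    [/\ forall i, open (G' i), A `<=` \bigcup_i G' i,
        forall i, G' i `<=` G i &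
        {in enum {ffun 'I_n -> 'I_m.+1}, forall c, good G' c}].
  elim: (enum _) => [|c cs [G' [oG' AG' G'G gG']]].
    by exists G; split=> // i x.
  pose H a := \bigcup_(i in [set i | c i = a]) G' i.
  have [||E [cE HE AE AE0]] := xA (fun a => ~` H a).
  - by move=> a; apply: open_closedC; exact: bigcup_open.
  - rewrite -subset0 => x [/AG'[i _ G'i] nH].
    by apply: (nH (c i) I); exists i.
  exists (fun i => G' i `&` ~` E (c i)); split.
  - by move=> i; apply: openI => //; exact: closed_openC.
  - move=> x Ax; have [a nEa] : exists a, ~ E a x.
      apply: contrapT => /forallNP nE; suff : (A `&` \bigcap_a E a) x.
        by rewrite AE0.
      by split=> // a _; exact: contrapT (nE a).
    have : H a x by apply: contrapT => /HE.
    by move=> [i /= ci G'i]; exists i; rewrite //= ci.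
  - by move=> i x [/G'G].
  - move=> c'; rewrite in_cons => /orP[/eqP-> x Ax|/gG' gc' x Ax].
      have [a _ Ea] := AE x Ax; exists a => i ca.
      by rewrite ca => -[].
    by have [a nG'] := gc' x Ax; exists a => i ci [/(nG' i ci)].
exists n, G'; split=> // [j|x Ax]; first by exists j.
rewrite leqNgt; apply/negP => big.
set S := [pred j | x \in G' j] in big.
(* This [c] numbers the members through [x], starting from 0. *)
pose c := [ffun i : 'I_n => inord (index i (enum S)) : 'I_m.+1].
have [|a nG'] := gG' c _ x Ax; first by rewrite mem_enum.
have aS : (a < size (enum S))%N by rewrite -cardE (leq_trans (ltn_ord a)).
have [i0 _] : exists i : 'I_n, i \in S.
  by apply/card_gt0P; exact: leq_ltn_trans big.
pose i := nth i0 (enum S) a.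
have iS : i \in S by rewrite -mem_enum mem_nth.
apply: (nG' i); last by move: iS; rewrite inE.
by rewrite ffunE index_uniq ?enum_uniq // inord_val.
Qed.

Lemma dim_lt_closed_sub A P m :
  closed A -> closed P -> A `<=` P -> dim_lt P m -> dim_lt A m.
Proof.
move=> cA cP AP dP; apply: expandable_dim_lt => F cF AF0.
have [||E [cE FE PE PE0 _]] := dim_lt_expand (F := fun i => A `&` F i) cP dP.
- by move=> i; exact: closedI.
- rewrite -subset0 => x [Px AFx].
  suff : (A `&` \bigcap_i F i) x by rewrite AF0.
  by split=> [|i _]; [have [] := AFx ord0 I|have [] := AFx i I].
exists (fun i => E i `|` F i); split.
- by move=> i; exact: closedU.
- by move=> i x Fx; right.
- by move=> x /AP/PE[i _ Ei]; exists i => //; left.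
- rewrite -subset0 => x [Ax EFx]; rewrite -PE0; split; first exact: AP.
  by move=> i _; have [//|Fi] := EFx i I; apply: FE.
Qed.

End covers.

(** * Separation in pseudometric spaces *)

Lemma open_bigcap_fin (T : topologicalType) (I : choiceType) (D : set I)
    (f : I -> set T) :
  finite_set D -> (forall i, open (f i)) -> open (\bigcap_(i in D) f i).
Proof.
move=> finD of_; rewrite -closedC setC_bigcap; apply: closed_bigcup => //.
by move=> i _; exact: open_closedC.
Qed.

Lemma open_fun_lt (R : realType) (T : topologicalType) (f g : T -> R) :
  continuous f -> continuous g -> open [set x | f x < g x].
Proof.
move=> cf cg; rewrite (_ : mkset _ = (g \- f) @^-1` [set r | 0 < r]).
  apply: open_comp => [x _|]; [|exact: open_gt].
  by apply: cvgB; [exact: cg|exact: cf].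
by apply/seteqP; split=> x /=; rewrite subr_gt0.
Qed.

Lemma closed_fun_le (R : realType) (T : topologicalType) (f g : T -> R) :
  continuous f -> continuous g -> closed [set x | f x <= g x].
Proof.
move=> cf cg; rewrite -openC (_ : ~` _ = [set x | g x < f x]).
  exact: open_fun_lt.
by apply/seteqP; split=> x /=; rewrite ltNge => /negP.
Qed.

Section separation.
Context {R : realType} {X : pseudoMetricType R}.
Implicit Types (A B U : set X).

(** The radii are bounded by 1 because arbitrarily large balls may lie in [U],
for instance if [U] is the whole space. *)
Definition inner_radii U (x : X) : set R :=
  [set r | 0 <= r <= 1 /\ (0 < r -> ball x r `<=` U)].

(** A replacement for the distance to the complement of [U]: it is continuous
for every [U], and positive exactly on [U] if [U] is open. *)
Definition depth U x : R := sup (inner_radii U x).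

Lemma inner_radii_has_sup U x : has_sup (inner_radii U x).
Proof.
split; first by exists 0; split; rewrite ?lexx ?ler01 ?ltxx.
by exists 1 => r [/andP[_ ->]].
Qed.

Lemma inner_radii_le U x r : inner_radii U x r -> r <= depth U x.
Proof.
by move=> Ur; apply: ub_le_sup => //; exact: (inner_radii_has_sup U x).2.
Qed.

Lemma depth_ge0 U x : 0 <= depth U x.
Proof. by apply: inner_radii_le; split; rewrite ?lexx ?ler01 ?ltxx. Qed.

Lemma depth_gt0 U x : 0 < depth U x -> U x.
Proof.
move=> U0; have [r [_ Ur] r0] := sup_adherent U0 (inner_radii_has_sup U x).
rewrite subrr in r0; exact: (Ur r0 _ (ballxx x r0)).
Qed.

Lemma open_depth_gt0 U x : open U -> U x -> 0 < depth U x.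
Proof.
rewrite openE => /[apply] /nbhs_ballP[r /= r0 rU].
have s0 : 0 < Num.min r 1 by rewrite lt_min r0 ltr01.
apply: lt_le_trans (s0) _; apply: inner_radii_le; split.
  by rewrite (ltW s0) ge_min lexx orbT.
by move=> _ y sy; apply/rU/(le_ball _ sy); rewrite ge_min lexx.
Qed.

Lemma depth_lipschitz U x y r :
  0 < r -> ball x r y -> depth U x <= depth U y + r.
Proof.
move=> r0 xy; apply: ge_sup => [|s [/andP[s0 s1] sU]].
  exact: (inner_radii_has_sup U x).1.
have [rs|sr] := ltP r s; last first.
  by apply: le_trans sr _; rewrite lerDr depth_ge0.
rewrite -lerBlDr; apply: inner_radii_le; split=> [|_ z yz].
  by rewrite subr_ge0 (ltW rs)/= (le_trans _ s1)// gerBl ltW.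
apply: (sU (lt_trans r0 rs)); rewrite -(subrKC r s).
exact: ball_triangle xy yz.
Qed.

Lemma depth_continuous U : continuous (depth U).
Proof.
move=> x; apply/cvgrPdist_le => e e0; near=> y.
have xy : ball x e y by near: y; exact: nbhsx_ballx.
have := depth_lipschitz U e0 xy; have := depth_lipschitz U e0 (ball_sym xy).
by move=> yx_le xy_le; rewrite ler_norml; apply/andP; split; lra.
Unshelve. all: by end_near. Qed.

Definition total_depth (I : finType) (U : I -> set X) x : R :=
  \sum_i depth (U i) x.

Lemma total_depth_continuous (I : finType) (U : I -> set X) :
  continuous (total_depth U).
Proof.
move=> x; rewrite /total_depth; apply: (@cvg_big _ _ +%R) => [|i _].
  exact: add_continuous.
exact: depth_continuous.
Qed.

Lemma total_depth_ge (I : finType) (U : I -> set X) i x :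
  depth (U i) x <= total_depth U x.
Proof.
rewrite /total_depth (bigD1 i)//= lerDl sumr_ge0// => j _; exact: depth_ge0.
Qed.

Lemma scaled_depth_continuous c U : continuous (fun x => c * depth U x).
Proof. by move=> x; apply: cvgMl_tmp; exact: depth_continuous. Qed.

(** The largest depth is at least the average. *)
Lemma exists_deep (I : finType) (U : I -> set X) x : 0 < total_depth U x ->
  exists i, total_depth U x <= #|I|%:R * depth (U i) x.
Proof.
move=> S0; apply: contrapT => /forallNP small.
have : \sum_(i : I) #|I|%:R * depth (U i) x < \sum_(i : I) total_depth U x.
  apply: ltr_sum => [|j _].
    move: S0; rewrite /total_depth has_predT.
    by case: (index_enum I) => //; rewrite big_nil ltxx.
  by rewrite ltNge; apply/negP/small.
by rewrite -mulr_sumr sumr_const mulr_natl ltxx.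
Qed.

Lemma closed_shrinking A (I : finType) (U : I -> set X) :
  closed A -> (forall i, open (U i)) -> A `<=` \bigcup_i U i ->
  exists D : I -> set X,
    [/\ forall i, closed (D i), forall i, D i `<=` A `&` U i &
        A `<=` \bigcup_i D i].
Proof.
move=> cA oU AU.
have S0 x : A x -> 0 < total_depth U x.
  move=> /AU[i _ Ui]; apply: lt_le_trans (total_depth_ge U i x).
  exact: open_depth_gt0.
exists (fun i => A `&` [set x | total_depth U x <= #|I|%:R * depth (U i) x]).
split=> [i|i x [Ax /= SU]|x Ax].
- apply: closedI => //; apply: closed_fun_le.
    exact: total_depth_continuous.
  exact: scaled_depth_continuous.
- split=> //; apply: depth_gt0.
  rewrite lt_neqAle eq_sym depth_ge0 andbT.
  by apply: contraTneq (lt_le_trans (S0 x Ax) SU) => ->; rewrite mulr0 ltxx.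
- by have [i SU] := exists_deep (S0 x Ax); exists i.
Qed.

Lemma open_between A U : closed A -> open U -> A `<=` U ->
  exists V, [/\ open V, A `<=` V & closure V `<=` U].
Proof.
move=> cA oU AU; exists [set x | depth (~` A) x < depth U x]; split.
- by apply: open_fun_lt; exact: depth_continuous.
- move=> x Ax /=; suff -> : depth (~` A) x = 0 by apply/open_depth_gt0/AU.
  by apply/eqP; rewrite eq_le depth_ge0 andbT leNgt; apply/negP => /depth_gt0.
- apply: subset_trans (_ : [set x | depth (~` A) x <= depth U x] `<=` _).
    rewrite [X in _ `<=` X](closure_id _).1; first by apply: closureS => x /ltW.
    by apply: closed_fun_le; exact: depth_continuous.
  move=> x /= le_AU; have [/AU//|nAx] := pselect (A x).
  apply: depth_gt0; apply: lt_le_trans le_AU; apply: open_depth_gt0 => //.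
  exact: closed_openC.
Qed.

Lemma separate_closed A B : closed A -> closed B -> A `&` B = set0 ->
  exists U W, [/\ open U, open W, A `<=` U, B `<=` W &
                  closure U `&` closure W = set0].
Proof.
move=> cA cB AB0.
have [||U [oU AU UB]] := @open_between A (~` B) cA.
- exact: closed_openC.
- by move=> x Ax Bx; have : (A `&` B) x by []; rewrite AB0.
have [||W [oW BW WU]] := @open_between B (~` closure U) cB.
- exact/closed_openC/closed_closure.
- by move=> x Bx /UB.
exists U, W; split=> //; rewrite -subset0 => x [Ux /WU]; exact.
Qed.

(** Outside [N] the complements of the [E i] form an open cover; a closed
shrinking [D] of it leaves room between [E i] and the complement of [D i]. *)
Lemma swelling (I : finType) (E : I -> set X) (N : set X) :
  (forall i, closed (E i)) -> open N -> \bigcap_i E i `<=` N ->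
  exists O : I -> set X,
    [/\ forall i, open (O i), forall i, E i `<=` O i &
        \bigcap_i closure (O i) `<=` N].
Proof.
move=> cE oN EN.
have [|||D [cD DE ND]] := @closed_shrinking (~` N) I (fun i => ~` E i).
- exact: open_closedC.
- by move=> i; exact: closed_openC.
- move=> x nNx; apply: contrapT => nE; apply/nNx/EN => i _.
  by apply: contrapT => nEi; apply: nE; exists i.
have betweenE i : exists V, [/\ open V, E i `<=` V & closure V `<=` ~` D i].
  apply: open_between => //; first exact: closed_openC.
  by move=> x Ex /DE[].
have [V OP] := choice betweenE.
exists V; split=> [i|i|x Vx]; [by have [] := OP i|by have [] := OP i|].
apply: contrapT => /ND[i _]; have [_ _] := OP i; apply; exact: Vx.
Qed.

End separation.

(** * Zero-dimensional pieces *)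

(** Only the part of [Z] inside the union of the [G i] has to be covered, so the
property passes to all subsets of [Z] and to the open parts of the space; the
sets [W i] are disjoint in the whole space and not only on [Z]. *)
Definition zero_dim (X : topologicalType) (Z : set X) : Prop :=
  forall (n : nat) (G : 'I_n -> set X), (forall i, open (G i)) ->
  exists W : 'I_n -> set X,
    [/\ forall i, open (W i), forall i, W i `<=` G i,
        forall i j x, W i x -> W j x -> i = j &
        Z `&` \bigcup_i G i `<=` \bigcup_i W i].

Lemma zero_dim_dim_lt (X : topologicalType) e (Z : 'I_e -> set X) (Q : set X) :
  (forall j, zero_dim (Z j)) -> Q `<=` \bigcup_j Z j -> dim_lt Q e.
Proof.
move=> Z0 QZ n G oG QG.
have [W WP] := choice (fun j => Z0 j n G oG).
pose V (ji : 'I_e * 'I_n) := W ji.1 ji.2.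
have [p [V' [V'V VV' card_V']]] := ord_family V.
exists p, V'; split=> [j'|x Qx|j'|x Qx].
- by have [ji ->] := V'V j'; have [oW _ _ _] := WP ji.1; exact: oW.
- have [j _ Zj] := QZ x Qx; have [_ _ _ ZW] := WP j.
  have [|i _ Wi] := ZW x; first by split=> //; exact: QG.
  by have [j' V'j'] := VV' (j, i); exists j'; rewrite ?V'j'.
- have [ji ->] := V'V j'; exists ji.2.
  by have [_ WG _ _] := WP ji.1; exact: WG.
- rewrite card_V' -[leqRHS]card_ord.
  rewrite -(fintype.card_in_image (f := fst)) ?max_card//.
  move=> [j i] [j' i']; rewrite !inE /V /= => Wi Wi' jj'; subst j'.
  by have [_ _ Winj _] := WP j; rewrite (Winj _ _ _ Wi Wi').
Qed.

Section partitions.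
Context {R : realType} {X : pseudoMetricType R}.
Implicit Types (A : set X) (S : set X * set X).

(** The theorem of Eilenberg and Otto. Refine, with order at most [e], the cover
by the sets that miss [P j] or [Q j] for each [j], and separate [P j] from
[Q j] by the points where a member that meets [P j] has depth [t j] times the
total depth, for [e] distinct values [t j]. A point of [A] on all the
partitions would lie in [e] different members, one for each value [t j]; the
deepest member at this point has a still greater depth and would be a member
number [e + 1]. *)
Lemma partition_tuple A e (P Q : 'I_e -> set X) :
  closed A -> dim_lt A e -> (forall j, closed (P j)) ->
  (forall j, closed (Q j)) -> (forall j, P j `&` Q j = set0) ->
  exists U W : 'I_e -> set X,
    [/\ forall j, open (U j) /\ open (W j),
        forall j, P j `<=` U j /\ Q j `<=` W j,
        forall j, closure (U j) `&` closure (W j) = set0 &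
        A `<=` \bigcup_j (U j `|` W j)].
Proof.
move=> cA dA cP cQ PQ0.
pose G (b : {ffun 'I_e -> bool}) := \bigcap_j (if b j then ~` Q j else ~` P j).
have [b||p [V [oV AV VG card_V]]] := dim_lt_fin (G := G) dA.
- apply: open_bigcap_fin => [|j]; first exact: finite_finset.
  by case: ifP => _; exact: closed_openC.
- move=> x _; exists [ffun j => ~~ `[< Q j x >]] => // j _.
  rewrite ffunE; have [Qx|nQx] := asboolP (Q j x) => //= Px.
  by have : (P j `&` Q j) x by []; rewrite PQ0.
pose M j := [set i | V i `&` P j !=set0].
have VQ j i x : M j i -> V i x -> ~ Q j x.
  have [b Vb] := VG i; move=> [y [/Vb/(_ j I) + Py]] /Vb/(_ j I).
  by case: (b j).
have S0 x : A x -> 0 < total_depth V x.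
  move=> /AV[i _ Vi]; apply: lt_le_trans (total_depth_ge V i x).
  exact: open_depth_gt0.
(* The inverses of the [c j] are the values [t j]. They are less than [1 / p],
   because the largest of [p] depths is at least [1 / p] times the total. *)
pose c (j : 'I_e) : R := (p + j).+1%:R.
have deepE x : A x -> exists i, [/\ V i x, 0 < depth (V i) x &
    forall j, total_depth V x < c j * depth (V i) x].
  move=> Ax; have [i Si] := exists_deep (S0 x Ax); exists i.
  have Vi0 : 0 < depth (V i) x.
    rewrite lt_neqAle eq_sym depth_ge0 andbT.
    by apply: contraTneq (lt_le_trans (S0 x Ax) Si) => ->; rewrite mulr0 ltxx.
  split=> // [|j]; first exact: depth_gt0.
  apply: le_lt_trans Si _; rewrite card_ord ltr_pM2r// ltr_nat ltnS.
  exact: leq_addr.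
pose U0 j := \bigcup_(i in M j) [set x | total_depth V x < c j * depth (V i) x].
pose W0 j := \bigcap_(i in M j) [set x | c j * depth (V i) x < total_depth V x].
have oU0 j : open (U0 j).
  apply: bigcup_open => i _; apply: open_fun_lt.
    exact: total_depth_continuous.
  exact: scaled_depth_continuous.
have oW0 j : open (W0 j).
  apply: open_bigcap_fin => [|i]; first exact: finite_finset.
  apply: open_fun_lt.
    exact: scaled_depth_continuous.
  exact: total_depth_continuous.
have UW0 j x : U0 j x -> W0 j x -> False.
  by move=> [i Mi /= lt1] /(_ i Mi)/= /(lt_trans lt1); rewrite ltxx.
have PU0 j x : A x -> P j x -> U0 j x.
  move=> Ax Px; have [i [Vi _ lt_i]] := deepE x Ax.
  by exists i; [exists x|exact: lt_i].
have QW0 j x : A x -> Q j x -> W0 j x.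
  move=> Ax Qx i Mi /=; suff -> : depth (V i) x = 0 by rewrite mulr0 S0.
  apply/eqP; rewrite eq_le depth_ge0 andbT leNgt.
  by apply/negP => /depth_gt0/(VQ j i x Mi).
have AUW0 x : A x -> exists j, U0 j x \/ W0 j x.
  move=> Ax; apply: contrapT => /forallNP nUW.
  have eqE j : exists i, M j i /\ c j * depth (V i) x = total_depth V x.
    apply: contrapT => /forallNP neq; apply: (nUW j); right=> i Mi /=.
    have [//|lt_i|eq_i] := ltgtP (c j * depth (V i) x) (total_depth V x).
      by case: (nUW j); left; exists i.
    by case: (neq i).
  have [g gP] := choice eqE.
  have g0 j : 0 < depth (V (g j)) x.
    rewrite lt_neqAle eq_sym depth_ge0 andbT; apply: contraTneq (S0 x Ax) => g0.
    by rewrite -(gP j).2 g0 mulr0 ltxx.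
  have g_inj : injective g.
    move=> j j' gjj'; have := (gP j).2; rewrite -(gP j').2 gjj'.
    move/(mulIf (lt0r_neq0 (g0 j')))/eqP.
    by rewrite eqr_nat eqSS eqn_add2l => /eqP/val_inj.
  have [i [Vi i0 lt_i]] := deepE x Ax.
  have := card_V x Ax; rewrite leqNgt => /negP; apply.
  rewrite -[X in (X < _)%N](card_ord e) -(fintype.card_image g_inj).
  apply: proper_card; apply/properP; split.
    apply/fintype.subsetP => _ /fintype.imageP[j _ ->].
    by rewrite inE; exact: depth_gt0 (g0 j).
  exists i; first by rewrite inE.
  apply/negP => /fintype.imageP[j _ ij].
  by have := lt_i j; rewrite ij (gP j).2 ltxx.
pose Y (jb : 'I_e * bool) := if jb.2 then U0 jb.1 else W0 jb.1.
have [||D [cD DY AD]] := closed_shrinking (U := Y) cA.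
- by move=> [j []]; [exact: oU0|exact: oW0].
- by move=> x /AUW0[j []]; [exists (j, true)|exists (j, false)].
have sepE j : exists UW : set X * set X,
    [/\ open UW.1, open UW.2, P j `|` D (j, true) `<=` UW.1,
        Q j `|` D (j, false) `<=` UW.2 & closure UW.1 `&` closure UW.2 = set0].
  have [|||U [W UWP]] := @separate_closed _ X (P j `|` D (j, true))
      (Q j `|` D (j, false)); [exact: closedU|exact: closedU| |].
  - rewrite -subset0 => x [[Px|/DY[Ax Ux]] [Qx|/DY[Ax' Wx]]].
    + by have : (P j `&` Q j) x by []; rewrite PQ0.
    + by apply: (UW0 j x) => //; exact: PU0.
    + by apply: (UW0 j x) => //; exact: QW0.
    + exact: (UW0 j x).
  - by exists (U, W).
have [UW UWP] := choice sepE.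
exists (fun j => (UW j).1), (fun j => (UW j).2); split.
- by move=> j; have [] := UWP j.
- move=> j; have [_ _ PU QW _] := UWP j.
  by split=> x Hx; [apply: PU|apply: QW]; left.
- by move=> j; have [] := UWP j.
- move=> x /AD[[j b] _ Dx]; have [_ _ PU QW _] := UWP j; exists j => //.
  by case: b Dx => Dx; [left; apply: PU|right; apply: QW]; right.
Qed.

Lemma exists_invS_le (e : R) : 0 < e -> exists n, n.+1%:R^-1 <= e.
Proof.
move=> e0; exists (Num.truncn e^-1).
by rewrite invf_ple ?posrE// ltW// truncnS_gt.
Qed.

(** The construction of Stone. The index [n] encodes a mesh [r m] and a margin
[r l]. The core of [s] consists of the points that have margin [r l] in the
open ball [C m s] but lie in no [C m t] for [t] before [s] in a well-ordering of the
space. Two points in different cores are not [r l]-close, so the neighbourhoods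
[B n s] of radius [r l / 3] of the cores are disjoint. *)
Lemma sigma_disjoint_base :
  exists (A : nat -> set X) (B : nat -> X -> set X),
    [/\ forall n, closed (A n), forall n s, open (B n s),
        forall n s t x, B n s x -> B n t x -> s = t,
        forall n, A n `<=` \bigcup_s B n s &
        forall x N, open N -> N x ->
          exists n s, [/\ A n x, B n s x & B n s `<=` N]].
Proof.
have [le wo] := wochoice.well_ordering_principle X.
have minE (D : set X) x : D x -> exists s, D s /\ forall t, D t -> le s t.
  move=> Dx; have [|s [[Ds le_s] _]] := wo [pred y | `[< D y >]].
    by exists x; exact/asboolP.
  exists s; split; first exact/asboolP.
  by move=> t Dt; apply: le_s; exact/asboolP.
have le_anti s t : le s t -> le t s -> s = t.
  move=> st ts; have [|u [_ u_uniq]] := wo [pred y | (y == s) || (y == t)].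
    by exists s; rewrite inE eqxx.
  have le_refl y : le y y.
    by have [z [-> /(_ y)]] := @minE [set y] y erefl; apply.
  have us : u = s.
    apply: u_uniq; split; first by rewrite inE eqxx.
    by move=> y; rewrite inE => /orP[/eqP->|/eqP->].
  rewrite -us; apply: u_uniq; split; first by rewrite inE eqxx orbT.
  by move=> y; rewrite inE => /orP[/eqP->|/eqP->].
pose r (n : nat) : R := n.+1%:R^-1.
have r0 n : 0 < r n by rewrite invr_gt0.
pose C m s : set X := (ball s (r m))°.
have Cxx m x : C m x x by exact/nbhsx_ballx.
pose ml n : nat * nat := odflt (0%N, 0%N) (unpickle n).
pose core n s : set X :=
  [set x | ball x (r (ml n).2) `<=` C (ml n).1 s /\
           forall t, C (ml n).1 t x -> le s t].
pose B n s : set X := \bigcup_(y in core n s) (ball y (r (ml n).2 / 3%:R))°.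
have third n : 0 < r n / 3%:R by rewrite divr_gt0.
exists (fun n => closure (\bigcup_s core n s)), B; split.
- by move=> n; exact: closed_closure.
- by move=> n s; apply: bigcup_open => y _; exact: open_interior.
- move=> n s t x [y [yC y_min] /interior_subset yx].
  move=> [z [zC z_min] /interior_subset zx].
  have yz : ball y (r (ml n).2) z.
    apply: le_ball (ball_triangle yx (ball_sym zx)).
    by have := r0 (ml n).2; move: (r (ml n).2) => q; lra.
  by apply: le_anti; [apply/y_min/zC/ball_sym|apply/z_min/yC].
- move=> n x; have sixth : 0 < r (ml n).2 / 6%:R by rewrite divr_gt0.
  move=> /(_ _ (nbhsx_ballx x _ sixth))[y [[s _ ys] xy]]; exists s => //.
  exists y => //; apply/nbhs_ballP; exists (r (ml n).2 / 6%:R) => //= z xz.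
  apply: le_ball (ball_triangle (ball_sym xy) xz).
  by have := r0 (ml n).2; move: (r (ml n).2) => q; lra.
- move=> x N oN Nx.
  have /nbhs_ballP[e /= e0 eN] : nbhs x N by exact: open_nbhs_nbhs.
  have e2 : 0 < e / 2 by rewrite divr_gt0.
  have [m me] := exists_invS_le e2.
  have [s [sx s_min]] := minE [set t | C m t x] x (Cxx m x).
  have /nbhs_ballP[d /= d0 dC] : nbhs x (C m s).
    by apply: open_nbhs_nbhs; split=> //; exact: open_interior.
  have [l ld] := exists_invS_le d0.
  have mlE : ml (pickle (m, l)) = (m, l) by rewrite /ml pickleK.
  have core_x : core (pickle (m, l)) s x.
    rewrite /core mlE; split=> //= y xy; apply: dC; exact: le_ball xy.
  exists (pickle (m, l)), s; split.
  + by apply: subset_closure; exists s.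
  + by exists x => //; exact: nbhsx_ballx.
  + rewrite /B /core mlE => y [z [zC _] /interior_subset zy]; apply: eN.
    have sy : C m s y.
      apply: zC; apply: le_ball zy.
      by rewrite ler_pdivrMr// ler_peMr ?(ltW (r0 _))// ler1n.
    apply: le_ball (ball_triangle (ball_sym (interior_subset sx))
                                  (interior_subset sy)).
    by rewrite [leRHS]splitr; exact: lerD.
Qed.

End partitions.

(** * Decomposition into zero-dimensional sets *)

(** On a set of points that lie in [V n] or [W n] for each [n], the traces of
[B n s] on [V n] form a base of clopen sets. Given open sets [G i], give each
of these traces that lies in some [G i] to the first such [i] ([E n i]), and
remove from stage [n] what was given away at earlier stages by intersecting
with the sets [H m]. *)
Lemma zero_dim_of_partitions (X : topologicalType) (T : Type)
    (A : nat -> set X) (B : nat -> T -> set X) (V W : nat -> set X) :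
  (forall n s, open (B n s)) ->
  (forall n s t x, B n s x -> B n t x -> s = t) ->
  (forall x N, open N -> N x ->
    exists n s, [/\ A n x, B n s x & B n s `<=` N]) ->
  (forall n, open (V n)) -> (forall n, open (W n)) ->
  (forall n, V n `&` W n = set0) ->
  (forall n, A n `<=` V n) ->
  (forall n, ~` (\bigcup_s B n s) `<=` W n) ->
  zero_dim [set x | forall n, V n x \/ W n x].
Proof.
move=> oB B_disj B_base oV oW VW0 AV BW k G oG.
pose fits n s i := B n s `&` V n `<=` G i.
pose first n s i := fits n s i /\ forall i' : 'I_k, fits n s i' -> (i <= i')%N.
pose E n i := \bigcup_(s in [set s | first n s i]) (B n s `&` V n).
pose H n := W n `|`
  \bigcup_(s in [set s | forall i, ~ fits n s i]) (B n s `&` V n).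
have oE n i : open (E n i).
  by apply: bigcup_open => s _; exact: openI.
have oH n : open (H n).
  by apply: openU => //; apply: bigcup_open => s _; exact: openI.
have EH n i x : E n i x -> H n x -> False.
  move=> [s [fs _] [Bx Vx]] [Wx|[t nft [Bx' _]]].
    by have : (V n `&` W n) x by []; rewrite VW0.
  by apply: (nft i); rewrite -(B_disj _ _ _ _ Bx Bx').
have E_inj n i j x : E n i x -> E n j x -> i = j.
  move=> [s [fs mins] [Bx _]] [t [ft mint] [Bx' _]].
  have st := B_disj _ _ _ _ Bx Bx'; subst t.
  by apply/val_inj/anti_leq; rewrite mins// mint.
have fits_first n s i : fits n s i -> exists j, first n s j.
  move=> fi; pose P (m : nat) := `[< exists j : 'I_k, m = j /\ fits n s j >].
  have exP : exists m, P m by exists i; apply/asboolP; exists i.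
  case: (ex_minnP exP) => _ /asboolP[j [-> fj]] j_min.
  by exists j; split=> // j' fj'; apply: j_min; apply/asboolP; exists j'.
exists (fun i => \bigcup_n (E n i `&` \bigcap_(m in `I_n) H m)); split.
- move=> i; apply: bigcup_open => n _; apply: openI => //.
  by apply: open_bigcap_fin => //; exact: finite_II.
- by move=> i x [n _ [[s [fs _] BVx] _]]; exact: fs.
- move=> i j x [n _ [Ei Hn]] [m _ [Ej Hm]].
  have [nm|mn|nm] := ltngtP n m.
  + by case: (EH n i x Ei (Hm n nm)).
  + by case: (EH m j x Ej (Hn m mn)).
  + by subst m; exact: E_inj Ei Ej.
- move=> x [Zx [i _ Gx]].
  pose P n := `[< exists j, E n j x >].
  have exP : exists n, P n.
    have [n [s [Ax Bx BG]]] := B_base x (G i) (oG i) Gx.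
    have [j fj] : exists j, first n s j.
      by apply: (fits_first _ _ i) => y [/BG].
    by exists n; apply/asboolP; exists j, s => //; split=> //; exact: AV.
  case: (ex_minnP exP) => n /asboolP[j Ex] n_min.
  exists j => //; exists n => //; split=> // m /= mn.
  have [Vx|Wx] := Zx m; last by left.
  have [[s _ Bx]|nO] := pselect ((\bigcup_s B m s) x); last by left; exact: BW.
  right; exists s => // i' fi'; have [j' fj'] := fits_first _ _ _ fi'.
  have : P m by apply/asboolP; exists j', s.
  by move=> /n_min; rewrite leqNgt mn.
Qed.

Section decomposition.
Context {R : realType} {X : pseudoMetricType R}.

Let separated (S : set X * set X) :=
  [/\ open S.1, open S.2 & closure S.1 `&` closure S.2 = set0].

(** Start from pairs of open sets with disjoint closures, and treat the
countably many choices [c] one after the other. A choice involves finitely many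
pairs; these are enlarged by [partition_tuple] so that they cover [A], and the
others do not change. The unions over all stages keep all that was achieved. *)
Lemma generic_partitions (A : set X) e (P Q : 'I_e -> nat -> set X) :
  closed A -> dim_lt A e -> (forall j n, closed (P j n)) ->
  (forall j n, closed (Q j n)) -> (forall j n, P j n `&` Q j n = set0) ->
  exists U W : 'I_e -> nat -> set X,
    [/\ forall j n, open (U j n) /\ open (W j n),
        forall j n, P j n `<=` U j n /\ Q j n `<=` W j n,
        forall j n, U j n `&` W j n = set0 &
        forall c : 'I_e -> nat, A `<=` \bigcup_j (U j (c j) `|` W j (c j))].
Proof.
move=> cA dA cP cQ PQ0.
pose state := 'I_e -> nat -> set X * set X.
pose sep (st : state) := forall j n, separated (st j n).
pose le (st st' : state) := forall j n,
  (st j n).1 `<=` (st' j n).1 /\ (st j n).2 `<=` (st' j n).2.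
have le_trans_st st1 st2 st3 : le st1 st2 -> le st2 st3 -> le st1 st3.
  move=> l12 l23 j n; have [h1 h2] := l12 j n; have [h3 h4] := l23 j n.
  by split; [exact: subset_trans h1 h3|exact: subset_trans h2 h4].
have stepE (p : state * {ffun 'I_e -> nat}) : exists st', sep p.1 ->
    [/\ sep st', le p.1 st' &
        A `<=` \bigcup_j ((st' j (p.2 j)).1 `|` (st' j (p.2 j)).2)].
  case: p => st c /=; have [sep_st|] := pselect (sep st); last by exists st.
  have [|||U [W [oUW UW cUW AUW]]] := @partition_tuple _ X A e
      (fun j => closure (st j (c j)).1) (fun j => closure (st j (c j)).2) cA dA.
  - by move=> j; exact: closed_closure.
  - by move=> j; exact: closed_closure.
  - by move=> j; have [] := sep_st j (c j).
  exists (fun j n => if n == c j then (U j, W j) else st j n) => _; split.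
  - move=> j n; case: eqP => _; last exact: sep_st.
    by have [oU oW] := oUW j; split=> //; exact: cUW.
  - move=> j n; case: eqP => [->|_]; last by split; exact: subset_refl.
    have [Uj Wj] := UW j.
    by split; [exact: subset_trans (@subset_closure _ _) Uj|
               exact: subset_trans (@subset_closure _ _) Wj].
  - by move=> x /AUW[j _ UWx]; exists j => //; rewrite eqxx.
have [step stepP] := choice stepE.
have initE (jn : 'I_e * nat) : exists S, separated S /\
    (P jn.1 jn.2 `<=` S.1 /\ Q jn.1 jn.2 `<=` S.2).
  have [U [W [oU oW PU QW UW0]]] := @separate_closed _ X _ _
    (cP jn.1 jn.2) (cQ jn.1 jn.2) (PQ0 jn.1 jn.2).
  by exists (U, W).
have [init initP] := choice initE.
(* Stage [t + 1] treats the choice with code [t], if there is one. *)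
pose st := fix st t : state := if t is t'.+1 then
    if unpickle t' is Some c then step (st t', c) else st t'
  else fun j n => init (j, n).
have sep_st t : sep (st t).
  elim: t => [|t IH] /=; first by move=> j n; exact: (initP (j, n)).1.
  by case: unpickle => [c|//]; have [] := stepP (st t, c) IH.
have le_refl st' : le st' st' by move=> j n; split; exact: subset_refl.
have st_mono t t' : (t <= t')%N -> le (st t) (st t').
  move=> /subnK <-; elim: (t' - t)%N => [|d IH]; first exact: le_refl.
  apply: le_trans_st IH _.
  rewrite addSn /=; case: unpickle => [c|]; last exact: le_refl.
  by have [] := stepP (st (d + t)%N, c) (sep_st _).
exists (fun j n => \bigcup_t (st t j n).1), (fun j n => \bigcup_t (st t j n).2).
split.
- by move=> j n; split; apply: bigcup_open => t _; have [] := sep_st t j n.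
- move=> j n; have [_ [PU QW]] := initP (j, n).
  by split=> x Hx; exists 0%N => //; [exact: PU|exact: QW].
- move=> j n; rewrite -subset0 => x [[t _ Ux] [t' _ Wx]].
  have [_ _ <-] := sep_st (maxn t t') j n; split; apply: subset_closure.
    exact: (st_mono t _ (leq_maxl _ _) j n).1.
  exact: (st_mono t' _ (leq_maxr _ _) j n).2.
- move=> c x Ax; pose c' := [ffun j => c j]; pose t := pickle c'.
  have := stepP (st t, c') (sep_st t) => -[_ _ /(_ x Ax)[j _]].
  rewrite /= ffunE => UWx; exists j => //.
  have stE : st t.+1 = step (st t, c') by rewrite /= pickleK.
  by case: UWx => ?; [left|right]; exists t.+1; rewrite ?stE.
Qed.

Lemma zero_dim_decomposition (A : set X) e : closed A -> dim_lt A e ->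
  exists Z : 'I_e -> set X, (forall j, zero_dim (Z j)) /\ A `<=` \bigcup_j Z j.
Proof.
move=> cA dA.
have [C [B [cC oB B_disj CB B_base]]] := @sigma_disjoint_base R X.
have [|||U [W [oUW PUW UW0 AUW]]] := @generic_partitions A e (fun _ => C)
    (fun _ n => ~` (\bigcup_s B n s)) cA dA.
- by move=> _; exact: cC.
- by move=> _ n; apply: open_closedC; exact: bigcup_open.
- by move=> _ n; rewrite -subset0 => x [/CB Bx /(_ Bx)].
exists (fun j => [set x | forall n, U j n x \/ W j n x]); split.
  move=> j; apply: (@zero_dim_of_partitions _ _ C B) => // n.
  - exact: (oUW j n).1.
  - exact: (oUW j n).2.
  - exact: (PUW j n).1.
  - exact: (PUW j n).2.
move=> x Ax; apply: contrapT => nZ.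
have cE (j : 'I_e) : exists n, ~ (U j n x \/ W j n x).
  by apply: contrapT => /forallNP nn; apply: nZ; exists j => // n;
     exact: contrapT (nn n).
have [c cP] := choice cE.
by have [j _] := AUW c x Ax; apply: cP.
Qed.

End decomposition.

(** * Comparison with the covering dimension of subspaces *)

Section covdim.

Lemma dim_lt_set0 (X : topologicalType) e : dim_lt (@set0 X) e.
Proof.
move=> n G _ _; exists 0%N, (fun=> set0).
by split=> [[]//|x|[]//|x].
Qed.

Lemma covdim_leE (T : topologicalType) d :
  covdim_le T d <-> dim_lt [set: T] d.+1.
Proof.
split=> dT n G.
  move=> oG TG; have [|p [V [[oV VT] VG card_V]]] := dT n G.
    by split=> //; apply/seteqP; split.
  by exists p, V; split=> //; rewrite VT.
move=> [oG GT]; have [|p [V [oV TV VG card_V]]] := dT n G oG.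
  by rewrite GT.
exists p, V; split=> // [|x]; last exact: card_V.
by split=> //; apply/seteqP; split.
Qed.

Lemma covdim_ltE (T : topologicalType) e :
  (covdim T < e%:Z%:E)%E <-> dim_lt [set: T] e.
Proof.
rewrite /covdim; case: asboolP => [T0|T0].
  by rewrite T0; split=> _; [exact: dim_lt_set0|rewrite lte_fin].
case: pselect => [ex|nex]; last first.
  split=> // dT; case: e dT => [/dim_lt0//|d /covdim_leE dT].
  by case: nex; exists d; apply/asboolP.
case: ex_minnP => m /asboolP mT m_min; rewrite lte_fin ltz_nat; split=> [me|dT].
  by apply: dim_lt_mono me _; apply/covdim_leE.
case: e dT => [/dim_lt0//|d /covdim_leE dT].
by rewrite ltnS; apply: m_min; apply/asboolP.
Qed.

Lemma open_subtype (X : topologicalType) (A : set X) (V : set A) :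
  open V -> exists N : set X, open N /\ set_val @^-1` N = V.
Proof. by move=> [N oN NV]; exists N. Qed.

Lemma dim_lt_subtype (X : topologicalType) (A : set X) e :
  dim_lt [set: A] e <-> dim_lt A e.
Proof.
split=> dA n G oG AG.
  have [||p [V [oV AV VG card_V]]] := dA n (fun i => set_val @^-1` G i).
  - by move=> i; exists (G i).
  - by move=> a _; have [i _ Gi] := AG _ (set_valP a); exists i.
  have [f fP] := choice VG.
  have [V' V'P] := choice (fun j => open_subtype (oV j)).
  exists p, (fun j => V' j `&` G (f j)).
  have in_V x (Ax : A x) j : V' j x -> V j (exist _ x (mem_set Ax)).
    by have [_ <-] := V'P j.
  split=> [j|x Ax|j|x Ax].
  - by apply: openI => //; have [] := V'P j.
  - have [j _ Vj] := AV (exist _ x (mem_set Ax)) I; exists j => //; split.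
      by move: Vj; have [_ <-] := V'P j.
    exact: fP Vj.
  - by exists (f j) => x [].
  - apply: leq_trans (card_V (exist _ x (mem_set Ax)) I).
    apply/subset_leq_card/fintype.subsetP => j; rewrite !inE => -[V'j _].
    exact: in_V.
have [G' G'P] := choice (fun i => open_subtype (oG i)).
have [||p [V [oV AV VG card_V]]] := dA n G'.
- by move=> i; have [] := G'P i.
- move=> x Ax; have [i _ Gi] := AG (exist _ x (mem_set Ax)) I; exists i => //.
  by move: Gi; have [_ <-] := G'P i.
exists p, (fun j => set_val @^-1` V j); split=> [j|a _|j|a _].
- by exists (V j).
- by have [j _ Vj] := AV _ (set_valP a); exists j.
- have [i Vi] := VG j; exists i => a /Vi.
  by have [_ <-] := G'P i.
- apply: leq_trans (card_V _ (set_valP a)).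
  by apply/subset_leq_card/fintype.subsetP => j; rewrite !inE.
Qed.

Lemma covdim_sub_ltE (X : topologicalType) (A : set X) e :
  (covdim A < e%:Z%:E)%E <-> dim_lt A e.
Proof. by rewrite covdim_ltE dim_lt_subtype. Qed.

Lemma covdim_eq (T : topologicalType) m :
  (covdim T < m.+1%:Z%:E)%E -> ~ (covdim T < m%:Z%:E)%E -> covdim T = m%:Z%:E.
Proof.
case: (covdim T) => [r| |]; last 2 first.
- by rewrite ltNge leey.
- by rewrite ltNyr.
- by rewrite !lte_fin => lt_rm ge_rm; congr (_%:E); lia.
Qed.

End covdim.

(** * Neighbourhoods and partitions of tuples *)

Section K_obs.
Context {X : topologicalType} {k : nat} (U : 'I_k.+1 -> set X).
Hypothesis oU : open_Ktuple U.

(** A point can be added to the [i]-th set of the tuple if it has a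
neighbourhood that misses [others i]. *)
Definition others i := \bigcap_(j in [set j | j != i]) U j.

Lemma K_obsE : K_obs U = \bigcap_i closure (others i).
Proof.
apply/seteqP; split=> [x obs_x i _|x Bx [V [[[V0 oV] UV] [i _ Vi]]]].
  apply: contrapT => nBi; apply: obs_x.
  (* Otherwise [x] can be added to the [i]-th set of the tuple. *)
  exists (fun j => if j == i then U i `|` ~` closure (others i) else U j).
  split; last by exists i; rewrite //= eqxx; right.
  split=> [|j]; last by case: eqP => [->|_ x' //]; exact: subsetUl.
  split=> [|j]; last first.
    case: eqP => _; last exact: oU.2.
    by apply: openU; [exact: oU.2|exact/closed_openC/closed_closure].
  rewrite /is_Ktuple -subset0 => y Vy.
  have Uy j : j != i -> U j y.
    by move=> ji; have := Vy j Logic.I; rewrite /= (negbTE ji).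
  have : (U i `|` ~` closure (others i)) y.
    by have := Vy i Logic.I; rewrite /= eqxx.
  case=> [Ui|]; last by apply; apply: subset_closure => j; exact: Uy.
  suff : (\bigcap_j U j) y by rewrite oU.1.
  by move=> j _; have [->//|/Uy] := eqVneq j i.
have [y [By Vy]] := Bx i Logic.I (V i) (open_nbhs_nbhs (conj (oV i) Vi)).
suff : (\bigcap_i V i) y by rewrite V0.
by move=> j _; have [->//|ji] := eqVneq j i; apply/UV/By.
Qed.

Lemma closed_K_obs : closed (K_obs U).
Proof. by rewrite K_obsE; apply: closed_bigI => i _; exact: closed_closure. Qed.

Lemma closed_K_compl : closed (K_compl U).
Proof. by apply: open_closedC; apply: bigcup_open => i _; exact: oU.2. Qed.

Lemma K_obs_compl : K_obs U `<=` K_compl U.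
Proof.
move=> x obs_x Ux; apply: obs_x; exists U; split=> //.
by split=> // i; exact: subset_refl.
Qed.

End K_obs.

Section Ktuples.
Context {R : realType} {X : pseudoMetricType R}.

(** Cover each of the first [k] zero-dimensional pieces by disjoint open sets
[W j i] that miss [F' i]. For fixed [j] a point lies in at most one of them, so
their unions [W' i] over [j] have no common point, being [k + 1] in number. The
set [U i] consists of a neighbourhood [F' i] of [F i] and of the union of all
[W' i'] without the [i]-th set of a relatively closed shrinking of their
family; this shrinking is defined by depths, so that [U i] is open in the whole
space. *)
Lemma K_nbhd_of_dim_lt k m : dim_lt [set: X] (k + m) ->
  forall F : 'I_k.+1 -> set X, closed_Ktuple F ->
  exists U, K_nbhd F U /\ dim_lt (K_compl U) m.
Proof.
move=> dX F [F0 cF].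
have [Z [Z0 XZ]] := zero_dim_decomposition closedT dX.
have [||F' [oF' FF' F'0]] := @swelling _ X _ F set0 cF.
- exact: open0.
- by rewrite F0.
have [W WP] := choice (fun j : 'I_k => Z0 (lshift m j) k.+1
  (fun i => ~` closure (F' i)) (fun i => closed_openC (@closed_closure _ _))).
pose W' i := \bigcup_j W j i.
have oW' i : open (W' i).
  by apply: bigcup_open => j _; have [oW _ _ _] := WP j; exact: oW.
have W'F' i x : W' i x -> ~ F' i x.
  move=> [j _ Wx] Fx; have [_ WF _ _] := WP j.
  by apply: (WF i x Wx); exact: subset_closure.
have W'0 x : exists i, ~ W' i x.
  apply: contrapT => /forallNP nW'.
  have gE i : exists j, W j i x by have [j _ Wj] := contrapT (nW' i); exists j.
  have [g gP] := choice gE.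
  suff /leq_card : injective g by rewrite !card_ord ltnn.
  move=> i i' gii'; have [_ _ Winj _] := WP (g i).
  by apply: (Winj _ _ x) => //; rewrite gii'.
pose U i := F' i `|` [set x | k.+1%:R * depth (W' i) x < total_depth W' x].
have FU i : F i `<=` U i by move=> x /FF'; left.
exists U; split; first split=> //; first split.
- rewrite /is_Ktuple -subset0 => x Ux.
  have [S0|S0] := ltP 0 (total_depth W' x).
    have [i deep_i] := exists_deep S0; rewrite card_ord in deep_i.
    have [F'x|/=] := Ux i Logic.I; last by rewrite ltNge deep_i.
    apply: (W'F' i x) => //; apply: depth_gt0.
    rewrite lt_neqAle eq_sym depth_ge0 andbT.
    by apply: contraTneq (lt_le_trans S0 deep_i) => ->; rewrite mulr0 ltxx.
  apply: (F'0 x) => i _; apply: subset_closure.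
  have [//|/= lt_i] := Ux i Logic.I.
  by move: (lt_le_trans lt_i S0); rewrite ltNge mulr_ge0 ?depth_ge0.
- move=> i; apply: openU => //; apply: open_fun_lt.
    exact: scaled_depth_continuous.
  exact: total_depth_continuous.
apply: (zero_dim_dim_lt (Z := fun j => Z (rshift k j))) => // x nUx.
have [j _ Zx] := XZ x Logic.I; case: (split_ordP j) => j' jE; subst j.
  exfalso; have [_ _ _ ZW] := WP j'.
  have [|i _ Wi] := ZW x.
    split=> //; apply: contrapT => nF'; apply: (F'0 x) => i _.
    by apply: contrapT => nF'i; apply: nF'; exists i.
  have W'i : W' i x by exists j'.
  have [i' nW'i'] := W'0 x; apply: nUx; exists i' => //; right => /=.
  suff -> : depth (W' i') x = 0.
    rewrite mulr0; apply: lt_le_trans (total_depth_ge W' i x).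
    exact: open_depth_gt0.
  by apply/eqP; rewrite eq_le depth_ge0 andbT leNgt; apply/negP => /depth_gt0.
by exists j'.
Qed.

(** Let [U] be a neighbourhood of the tuple formed by the first [k] sets [F i]
and by the intersection of the others. Expand these others over the partition
of [U]; the expanded sets [E j] meet only in the last [U i]. Replacing the last
[U i] by its unions with small neighbourhoods of the [E j] gives an open cover
of the space, still without a common point. *)
Lemma dim_lt_of_K_nbhd k m :
  (forall F : 'I_k.+1 -> set X, closed_Ktuple F ->
   exists U, K_nbhd F U /\ dim_lt (K_compl U) m) ->
  dim_lt [set: X] (k + m).
Proof.
move=> nbhdF; apply: expandable_dim_lt => F cF; rewrite setTI => F0.
pose hi (j : 'I_m.+1) : 'I_(k + m).+1 := inord (k + j).
have hiK (j : 'I_m.+1) : hi j = (k + j)%N :> nat.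
  by rewrite inordK// ltnS leq_add2l -ltnS.
have hi_sub (i : 'I_(k + m).+1) : (k <= i)%N -> hi (inord (i - k)) = i.
  move=> ki; apply/val_inj; rewrite /= hiK inordK ?subnKC//.
  by rewrite ltnS leq_subLR -ltnS.
pose lo (i : 'I_k.+1) : 'I_(k + m).+1 := inord i.
have loK (i : 'I_k.+1) : lo i = i :> nat.
  by rewrite inordK// (leq_trans (ltn_ord i))// ltnS leq_addr.
have lo_inord (i : 'I_(k + m).+1) : (i < k)%N -> lo (inord i) = i.
  by move=> ik; apply/val_inj; rewrite /= loK inordK// ltnW.
pose F' (i : 'I_k.+1) := if (i < k)%N then F (lo i) else \bigcap_j F (hi j).
have [|U [[[U0 oU] FU] dU]] := nbhdF F'.
  split=> [|i]; last first.
    by rewrite /F'; case: ifP => // _; apply: closed_bigI => j _.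
  rewrite /is_Ktuple -subset0 => x F'x; rewrite -F0 => i _.
  have [ik|ki] := ltnP i k.
    have := F'x (inord i) Logic.I.
    by rewrite /F' inordK ?ik ?lo_inord// ltnW.
  have := F'x ord_max Logic.I.
  by rewrite /F' /= ltnn => /(_ (inord (i - k)) Logic.I); rewrite hi_sub.
have cU : closed (K_compl U) by exact: closed_K_compl.
have FhiU : \bigcap_j F (hi j) `<=` U ord_max.
  by move=> x Fx; apply: FU; rewrite /F' /= ltnn.
have [||E [cE FE UE _ EF]] := dim_lt_expand (F := fun j => F (hi j)) cU dU.
- by [].
- by rewrite -subset0 => x [nUx /FhiU Ux]; apply: nUx; exists ord_max.
have [|V [oV EV V_U]] := @swelling _ X _ E (U ord_max) cE (oU _).
  exact: subset_trans EF FhiU.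
pose Y (i : 'I_(k + m).+1) :=
  if (i < k)%N then U (inord i) else U ord_max `|` V (inord (i - k)).
have FY i : F i `<=` Y i.
  rewrite /Y; case: ltnP => ik x Fx.
    by apply: FU; rewrite /F' inordK ?ik ?lo_inord// ltnW.
  by right; apply/EV/FE; rewrite hi_sub.
have Y0 : \bigcap_i Y i = set0.
  rewrite -subset0 => x Yx; rewrite -U0 => i _.
  have [ik|ki] := ltnP i k.
    have := Yx (lo i) Logic.I; rewrite /Y loK ik.
    by rewrite inord_val.
  have -> : i = ord_max.
    by apply/val_inj/eqP; rewrite /= eqn_leq ki -ltnS ltn_ord.
  apply: contrapT => nUx; apply/nUx/V_U => j _; apply: subset_closure.
  have := Yx (hi j) Logic.I; rewrite /Y hiK ltnNge leq_addr /= addKn inord_val.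
  by case.
have [|||D [cD DY TD]] := @closed_shrinking _ X [set: X] _ Y.
- exact: closedT.
- by move=> i; rewrite /Y; case: ifP => // _; exact: openU.
- move=> x _; have [[i _ Ux]|nUx] := pselect ((\bigcup_i U i) x).
    exists (lo i) => //; rewrite /Y loK; case: ltnP => ik.
      by rewrite inord_val.
    left; suff <- : i = ord_max by [].
    by apply/val_inj/eqP; rewrite /= eqn_leq ik -ltnS ltn_ord.
  have [j _ Ex] := UE x nUx; exists (hi j) => //.
  by rewrite /Y hiK ltnNge leq_addr /= addKn inord_val; right; exact: EV.
exists (fun i => F i `|` D i); split.
- by move=> i; exact: closedU.
- by move=> i x Fx; left.
- by move=> x /TD[i _ Dx]; exists i => //; right.
- rewrite setTI -subset0 => x FDx; rewrite -Y0 => i _.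
  by have [/FY//|/DY[]] := FDx i Logic.I.
Qed.

(** A closed tuple is first expanded over [A], then swollen, and finally
expanded over what the swollen sets leave uncovered, which is disjoint from
[A]. *)
Lemma dim_lt_closed_union (A P : set X) m :
  closed A -> closed P -> A `<=` P -> dim_lt A m ->
  (forall Q, closed Q -> Q `<=` P -> Q `&` A = set0 -> dim_lt Q m) ->
  dim_lt P m.
Proof.
move=> cA cP AP dA dQ; apply: expandable_dim_lt => F cF PF0.
have [|E [cE FE AE _ EF]] := dim_lt_expand cA dA cF.
  by rewrite -subset0 => x [/AP Px Fx]; rewrite -PF0.
have [||V [oV EV VP]] := @swelling _ X _ E (~` P) cE; first exact: closed_openC.
  by move=> x /EF Fx Px; have : (P `&` \bigcap_i F i) x by []; rewrite PF0.
pose Q := P `&` ~` (\bigcup_i V i).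
have cQ : closed Q.
  by apply: closedI => //; apply: open_closedC; exact: bigcup_open.
have {}dQ : dim_lt Q m.
  apply: dQ => //; first exact: subIsetl.
  rewrite -subset0 => x [[_ nVx] /AE[i _ /EV Vx]].
  by apply: nVx; exists i.
have [||E' [cE' VE' QE' _ E'V]] :=
    dim_lt_expand (F := fun i => closure (V i)) cQ dQ.
- by move=> i; exact: closed_closure.
- by rewrite -subset0 => x [[Px _] /VP].
exists E'; split=> //.
- move=> i; apply: subset_trans (VE' i).
  apply: subset_trans (@subset_closure _ _).
  exact: subset_trans (FE i) (EV i).
- move=> x Px; have [[i _ Vx]|nVx] := pselect ((\bigcup_i V i) x).
    by exists i => //; apply/VE'/subset_closure.
  exact: QE'.
- by rewrite -subset0 => x [Px /E'V/VP].
Qed.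

(** Outside the obstruction set each point belongs to some [G i], the complement
of the closure of [others U i]. Disjoint open sets [W i] in the [G i] can be
added to the sets [U i], and they can be chosen so that outside the obstruction
set they contain one of the [m + 1] zero-dimensional pieces of the partition.
What remains is the obstruction set together with a part of the other [m]
pieces. *)
Lemma K_nbhd_enlarge k m (U : 'I_k.+1 -> set X) :
  open_Ktuple U -> dim_lt (K_compl U) m.+1 -> dim_lt (K_obs U) m ->
  exists V, K_nbhd U V /\ dim_lt (K_compl V) m.
Proof.
move=> oU dP dobs.
have [Z [Z0 PZ]] := zero_dim_decomposition (closed_K_compl oU) dP.
have [W [oW WB Winj ZW]] := Z0 ord0 k.+1 (fun i => ~` closure (others U i))
  (fun i => closed_openC (@closed_closure _ _)).
pose V i := U i `|` W i.
have UV : K_nbhd U V.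
  split; last by move=> i; exact: subsetUl.
  split; last by move=> i; apply: openU => //; exact: oU.2.
  rewrite /is_Ktuple -subset0 => x Vx.
  have [[i Wi]|nW] := pselect (exists i, W i x); last first.
    rewrite -(oU.1) => i _; have [//|Wi] := Vx i Logic.I.
    by case: nW; exists i.
  apply: (WB i x Wi); apply: subset_closure => j /= ji.
  by have [//|Wj] := Vx j Logic.I; rewrite (Winj _ _ _ Wj Wi) eqxx in ji.
exists V; split=> //.
apply: (@dim_lt_closed_union (K_obs U)) => //.
- exact: closed_K_obs.
- exact: closed_K_compl UV.1.
- by move=> x obs_x Vx; apply: obs_x; exists V.
move=> Q _ QV Qobs0.
apply: (zero_dim_dim_lt (Z := fun j => Z (lift ord0 j))) => //.
move=> x Qx; have nVx := QV x Qx.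
have [|j _ Zx] := PZ x.
  by move=> [i _ Ux]; apply: nVx; exists i => //; left.
case: (unliftP ord0 j) Zx => [j' ->|-> Zx]; first by exists j'.
exfalso; have [|i _ Wi] := ZW x; last by apply: nVx; exists i => //; right.
split=> //; apply: contrapT => nB.
have : (Q `&` K_obs U) x; last by rewrite Qobs0.
split=> //; rewrite K_obsE// => i _; apply: contrapT => nBi.
by apply: nB; exists i.
Qed.

(** Otherwise each closed tuple has a neighbourhood that can be enlarged so that
its partition has dimension less than [m], which bounds [dim X]. *)
Lemma obstructed_Ktuple k m : ~ dim_lt [set: X] (k + m) ->
  exists F : 'I_k.+1 -> set X, closed_Ktuple F /\
    forall U, K_nbhd F U ->
      covdim (K_obs U) = m%:Z%:E \/ (m%:Z%:E < covdim (K_compl U))%E.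
Proof.
move=> ndX; apply: contrapT => /forallNP nF; apply: ndX.
apply: dim_lt_of_K_nbhd => F cF; apply: contrapT => nU.
apply: (nF F); split=> // U FU.
apply: contrapT => /not_orP[obs_neq /negP]; rewrite -leNgt => P_le.
have oU := FU.1.
have dP : dim_lt (K_compl U) m.+1.
  by apply/covdim_sub_ltE; apply: le_lt_trans P_le _; rewrite lte_fin ltz_nat.
have dobs : dim_lt (K_obs U) m.+1.
  apply: dim_lt_closed_sub dP; [exact: closed_K_obs|exact: closed_K_compl|].
  exact: K_obs_compl.
have [|V [UV dV]] := K_nbhd_enlarge oU dP.
  apply/covdim_sub_ltE; apply: contrapT => nlt; apply: obs_neq.
  by apply: covdim_eq => //; apply/covdim_sub_ltE.
apply: nU; exists V; split=> //; split; first exact: UV.1.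
by move=> i; apply: subset_trans (UV.2 i); exact: FU.2.
Qed.

End Ktuples.

(** * The inductive dimension *)

Lemma KInd_le_ord_of_nat (R : realType) k n (X : pseudoMetricType R) :
  KInd_le k (ord_of_nat n) X <-> dim_lt [set: X] (k * n.+1).
Proof.
rewrite mulnS; elim: n X => [|n IH] X.
  rewrite muln0; split=> [KX|dX F /(K_nbhd_of_dim_lt dX)[U [FU dU]]].
    apply: dim_lt_of_K_nbhd => F /KX[_ [[U [FU ->]] [P0|[[]]]]].
    by exists U; rewrite P0; split=> //; exact: dim_lt_set0.
  exists (K_compl U); split; first by exists U.
  by left; exact: dim_lt0.
split=> [KX|dX F /(K_nbhd_of_dim_lt dX)[U [FU dU]]].
  apply: dim_lt_of_K_nbhd => F /KX[_ [[U [FU ->]] PU]].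
  exists U; split=> //; case: PU => [->|[_ KU]]; first exact: dim_lt_set0.
  by apply/dim_lt_subtype; rewrite mulnS; apply/IH.
exists (K_compl U); split; first by exists U.
by right; exists tt; apply/IH/dim_lt_subtype; rewrite -mulnS.
Qed.

Lemma olt_ole_trans a b c : olt a b -> ole b c -> olt a c.
Proof.
case: b c => T f [T2 g] [i af] fg; have [j fgj] := fg i.
by exists j; exact: ole_trans af fgj.
Qed.

Theorem proposition2p7 (R : realType) (k : nat) (hk : (1 <= k)%N) :
  (forall (m : nat) (X : metricType R),
     ((k + m)%:Z%:E <= covdim X)%E ->
     exists F : 'I_k.+1 -> set X, closed_Ktuple F /\
       forall U : 'I_k.+1 -> set X, K_nbhd F U ->
         covdim (K_obs U) = m%:Z%:E \/ (m%:Z%:E < covdim (K_compl U))%E)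
  /\
  (forall (n : nat) (X : metricType R), (1 <= n)%N ->
     covdim X = ((k * n.+1)%:Z - 1)%:E ->
     KInd_is k X (Ind_ord (ord_of_nat n)) /\ Kstr k X = 1%N).
Proof.
have obstructed (m : nat) (X : metricType R) : ((k + m)%:Z%:E <= covdim X)%E ->
    ~ dim_lt [set: X] (k + m).
  by move=> dX /covdim_ltE; rewrite ltNge dX.
split=> [m X /obstructed|n X n1 dX]; first exact: obstructed_Ktuple.
have dX_lt e : dim_lt [set: X] e <-> (k * n.+1 <= e)%N.
  by rewrite -covdim_ltE dX lte_fin; lia.
have kn : (k <= k * n)%N by rewrite leq_pmulr.
have X_neq0 : [set: X] <> set0.
  move=> X0; suff : dim_lt [set: X] 0 by rewrite dX_lt; lia.
  by rewrite X0; exact: dim_lt_set0.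
have KX : KInd_is k X (Ind_ord (ord_of_nat n)).
  split=> //; first by apply/KInd_le_ord_of_nat/dX_lt.
  move=> b bX; case: (ole_or_olt (ord_of_nat n) b) => // bn.
  case: n n1 dX dX_lt kn bn => // n _ _ dX_lt kn /= [_ bn].
  have /KInd_le_ord_of_nat/dX_lt := KInd_le_mono bn bX; lia.
split=> //; rewrite /Kstr; case: asboolP => //.
case=> [//|[_ K0 _]|[_ /(_ (ord_of_nat n))]|].
- by move/KInd_le_ord_of_nat/dX_lt: K0; lia.
- by case: KX.
move=> [a [[_ _ a_min] _ strF]].
(* The first part applies with [m = k * n - 1], as [k + m = k * (n + 1) - 1]. *)
have [F [cF FU]] : exists F : 'I_k.+1 -> set X, closed_Ktuple F /\
    forall U : 'I_k.+1 -> set X, K_nbhd F U ->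
      covdim (K_obs U) = (k * n).-1%:Z%:E \/
      ((k * n).-1%:Z%:E < covdim (K_compl U))%E.
  by apply: obstructed_Ktuple; rewrite dX_lt; lia.
have [U [/FU KU obs0 Ulta]] := strF F cF.
case: KU => [obs_eq|].
  have : (covdim (K_obs U) < 0%:Z%:E)%E.
    by apply/covdim_sub_ltE; rewrite obs0; exact: dim_lt_set0.
  by rewrite obs_eq lte_fin.
rewrite ltNge => /negP[].
have dU : dim_lt (K_compl U) (k * n).
  apply/dim_lt_subtype; case: Ulta => [->|[b [ba bU]]].
    exact: dim_lt_set0.
  have [_ nX _] := KX; have := olt_ole_trans ba (a_min _ nX).
  case: n n1 {dX dX_lt kn KX FU nX a_min} => // n _ [_ bn].
  by apply/KInd_le_ord_of_nat; exact: KInd_le_mono bn bU.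
have : (covdim (K_compl U) < (k * n)%:Z%:E)%E by apply/covdim_sub_ltE.
case: (covdim (K_compl U)) => [r| |].
- by rewrite lte_fin lee_fin; lia.
- by rewrite ltNge leey.
- by rewrite leNye.
Qed.
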